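(* Let $\{\mathcal X_k\}_{k\in\mathbb N}$, $\{\overline{\mathcal X}_k\}_{k\ge1}$ and $\{\mathcal Y_k\}_{k\in\mathbb N}$ be the sequences of sets defined in the context, and let $\mathcal M$ be the maximal robust positively invariant set. The following statements are equivalent: (i) $\mathcal M$ is finitely determined, i.e. there exists $k\in\mathbb N$ with $\mathcal M=\mathcal X_k$; (ii) there exists $k\in\mathbb N$ such that $\mathcal X_k\subseteq\mathcal X_{k+1}$; (iii) there exists $k\in\mathbb N$ such that $\mathcal X_k\subseteq\overline{\mathcal X}_{k+1}$; (iv) there exists $k\in\mathbb N$ such that $\mathcal X_k\subseteq\mathcal Y_{k+1}$. Moreover, if any one of the inclusions $\mathcal X_k\subseteq\mathcal X_{k+1}$, $\mathcal X_k\subseteq\overline{\mathcal X}_{k+1}$, or $\mathcal X_k\subseteq\mathcal Y_{k+1}$ holds for some $k\in\mathbb N$, then $\mathcal M=\mathcal X_\infty=\mathcal X_k=\mathcal X_{k+1}$, where $\mathcal X_\infty:=\bigcap_{j\in\mathbb N}\mathcal X_j$.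
   Context: $\mathbb N$ denotes the nonnegative integers. Let $\mathscr A\subseteq\mathbb R^{n\times n}$ be a nonempty family of matrices, $\mathcal W\subseteq\mathbb R^n$ a nonempty set, $\mathcal X\subseteq\mathbb R^n$ a set, and $\mathcal F(x):=\{Ax+w: A\in\mathscr A,\ w\in\mathcal W\}$. A set $\mathcal S\subseteq\mathbb R^n$ is robust positively invariant if for all $x\in\mathcal S$ one has $\mathcal F(x)\subseteq\mathcal S$ and $x\in\mathcal X$; the maximal robust positively invariant set $\mathcal M$ is the (existing, unique) robust positively invariant set containing every other one. For sets $\mathcal S,\mathcal D\subseteq\mathbb R^n$ with $\mathcal D$ nonempty, $\mathcal S\ominus\mathcal D:=\{z\in\mathbb R^n: z+\mathcal D\subseteq\mathcal S\}$ (Pontryagin difference); for a matrix $M$, $M^{-1}\mathcal S:=\{x:Mx\in\mathcal S\}$ (preimage); sums of sets are Minkowski sums. For $k\ge1$, $\mathfrak B_k(\mathscr A)$ is the set of tuples $\boldsymbol\Psi_k=(\Psi_{k,0},\dots,\Psi_{k,k})$ generated by $A_0,\dots,A_{k-1}\in\mathscr A$ via $\Psi_{k,k}:=I$ and $\Psi_{k,i}:=A_{k-1}A_{k-2}\cdots A_i$ for $0\le i\le k-1$. Set $\mathcal Y_0:=\mathcal X$ and, for $k\ge1$, $$\mathcal Y_k:=\bigcap_{\boldsymbol\Psi_k\in\mathfrak B_k(\mathscr A)}\Psi_{k,0}^{-1}\Big(\mathcal X\ominus\sum_{i=0}^{k-1}\Psi_{k,i+1}\mathcal W\Big).$$ The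 sequence $\{\mathcal X_k\}$ is given by $\mathcal X_0:=\mathcal X$ and any one of the following recursions (which generate the same sequence), where $\overline{\mathcal X}_{k+1}:=\bigcap_{A\in\mathscr A}A^{-1}(\mathcal X_k\ominus\mathcal W)$ for $k\in\mathbb N$: standard, $\mathcal X_{k+1}=\overline{\mathcal X}_{k+1}\cap\mathcal X$; self-restricted, $\mathcal X_{k+1}=\overline{\mathcal X}_{k+1}\cap\mathcal X_k$; incremental, $\mathcal X_{k+1}=\mathcal X_k\cap\mathcal Y_{k+1}$. *)

(* Defs.v *)
From HB Require Import structures.
From mathcomp Require Import all_boot all_order all_algebra.
From mathcomp Require Import boolp classical_sets reals.

Set Implicit Arguments.
Unset Strict Implicit.
Unset Printing Implicit Defensive.

Import Order.TTheory GRing.Theory Num.Theory.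

Local Open Scope classical_set_scope.
Local Open Scope ring_scope.

Section SetOperations.
Context {R : realType} {n : nat}.
Implicit Types S D : set 'cV[R]_n.

Definition minkowski_sum S D : set 'cV[R]_n := [set s + d | s in S & d in D].

Definition pontryagin_diff S D : set 'cV[R]_n :=
  [set z | [set z + d | d in D] `<=` S].

End SetOperations.

Inductive recursion := Standard | SelfRestricted | Incremental.

Section LinearDifferenceInclusion.
Context {R : realType} {n : nat}.
Variables (sA : set 'M[R]_n) (W X : set 'cV[R]_n).

Definition succ_set (x : 'cV[R]_n) : set 'cV[R]_n :=
  [set A *m x + w | A in sA & w in W].

Definition rpi (S : set 'cV[R]_n) : Prop :=
  forall x, S x -> succ_set x `<=` S /\ X x.

Definition max_rpi (M : set 'cV[R]_n) : Prop :=
  rpi M /\ forall S, rpi S -> S `<=` M.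

Lemma max_rpi_exists : exists M, max_rpi M.
Proof.
exists (\bigcup_(S in rpi) S); split; last by move=> S rS x Sx; exists S.
move=> x [S rS Sx]; have [FS Xx] := rS x Sx.
by split=> // y /FS Sy; exists S.
Qed.

Lemma max_rpi_unique M1 M2 : max_rpi M1 -> max_rpi M2 -> M1 = M2.
Proof. by move=> [r1 m1] [r2 m2]; apply/seteqP; split; [exact: m2|exact: m1]. Qed.

(* The product is taken over j = k - 1, k - 2, ..., i in this order, i.e.
   A_(k-1) *m ... *m A_i; it is empty, hence the identity, when i = k. *)
Definition transition (A : nat -> 'M[R]_n) (k i : nat) : 'M[R]_n :=
  \big[mulmx/1%:M]_(j <- rev (index_iota i k)) A j.

(* Only the values A_0, ..., A_(k-1) of the sequence A are relevant. *)
Definition transition_tuples (k : nat) : set ('I_k.+1 -> 'M[R]_n) :=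
  [set Psi | exists2 A : nat -> 'M[R]_n,
     forall j, (j < k)%N -> sA (A j) &
     forall i : 'I_k.+1, Psi i = transition A k i].
Arguments transition_tuples k : clear implicits.

(* [lift ord0 i : 'I_k.+1] has value i + 1. *)
Definition Yset (k : nat) : set 'cV[R]_n :=
  if k is 0%N then X else
  \bigcap_(Psi in transition_tuples k)
    (mulmx (Psi ord0) @^-1`
      (pontryagin_diff X
        (\big[minkowski_sum/[set 0]]_(i < k) (mulmx (Psi (lift ord0 i)) @` W)))).

Definition backward_set (S : set 'cV[R]_n) : set 'cV[R]_n :=
  \bigcap_(A in sA) (mulmx A @^-1` (pontryagin_diff S W)).

Fixpoint Xset (r : recursion) (k : nat) : set 'cV[R]_n :=
  if k is k'.+1 then
    match r with
    | Standard => backward_set (Xset r k') `&` X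
    | SelfRestricted => backward_set (Xset r k') `&` Xset r k'
    | Incremental => Xset r k' `&` Yset k'.+1
    end
  else X.

(* Meaningful for k >= 1 only; the value at k = 0 is a dummy. *)
Definition Xbar (r : recursion) (k : nat) : set 'cV[R]_n :=
  backward_set (Xset r k.-1).

Definition Xinf (r : recursion) : set 'cV[R]_n := \bigcap_k Xset r k.

Definition finitely_determined (r : recursion) (M : set 'cV[R]_n) : Prop :=
  exists k, M = Xset r k.

End LinearDifferenceInclusion.

Arguments transition_tuples {R n} sA k _.

(* Main.v *)
Require Import Defs.
From HB Require Import structures.
From mathcomp Require Import all_boot all_order all_algebra.
From mathcomp Require Import boolp classical_sets reals.

(** The sets of the theorem are all governed by the one-step backward operator
[B S = backward_set sA W S], the set of the states all of whose successors lie
in [S].  It is monotone and commutes with intersections.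

Peeling the first step off a trajectory gives [Y_(k+1) = B Y_k]
([Yset_backward]): [Y_k] is the set of the states from which every admissible
trajectory is in [X] at time [k].  By induction each of the three recursions
then produces [X_k = Y_0 `&` ... `&` Y_k] ([Xset_bigcap]), and therefore, for
each of them,
[[
   X_(k+1) = X_k `&` Y_(k+1) = X_k `&` B X_k.
]]
So the inclusions of [X_k] in [X_(k+1)], in [B X_k] and in [Y_(k+1)] say the
same thing ([Xset_stopping]).  A subset of [X] is robust positively invariant
exactly when it is contained in its own image under [B] ([rpiE]); hence any of
the inclusions makes [X_k] invariant, so that [X_k] is contained in [M].
Conversely [M] is contained in every [X_j], because invariance of [M]
propagates along [B] ([rpi_sub_Xset]).  This squeezes [M] and the intersection
of all [X_j] between [X_k] and itself. *)

Set Implicit Arguments.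
Unset Strict Implicit.
Unset Printing Implicit Defensive.

Import Order.TTheory GRing.Theory Num.Theory.

Local Open Scope classical_set_scope.
Local Open Scope ring_scope.

Lemma transition_shift (R : realType) (n : nat) (A : nat -> 'M[R]_n) k i :
  transition A k.+1 i.+1 = transition (A \o S) k i.
Proof.
by rewrite /transition /index_iota subSS -[i.+1]add1n iotaDl -map_rev big_map.
Qed.

Lemma transition_first (R : realType) (n : nat) (A : nat -> 'M[R]_n) k :
  transition A k.+1 0 = transition (A \o S) k 0 *m A 0%N.
Proof.
rewrite -transition_shift /transition /index_iota subn0 subSS subn0 /=.
rewrite rev_cons; elim: (rev _) => [|j s IHs] /=.
  by rewrite big_cons big_nil mul1mx mulmx1.
by rewrite !big_cons IHs mulmxA.
Qed.

(** The disturbances are indexed by [nat], like the matrices in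
[transition_tuples], so that the time shift of [Yset_backward] acts on both in
the same way. *)
Lemma mem_sum_images (R : realType) (n : nat) (W : set 'cV[R]_n) k
    (P : nat -> 'M[R]_n) (z : 'cV[R]_n) :
  (\big[minkowski_sum/[set 0]]_(i < k) (mulmx (P i) @` W)) z <->
  exists2 w : nat -> 'cV[R]_n, forall j, (j < k)%N -> W (w j) &
    z = \sum_(i < k) P i *m w i.
Proof.
elim: k P z => [|k IHk] P z.
  rewrite big_ord0; split=> [->|[w _ ->]]; last by rewrite big_ord0.
  by exists (fun=> 0) => //; rewrite big_ord0.
rewrite big_ord_recl; split=> [[_ [w0 Ww0 <-]] [d Dd <-]|[w Ww ->]].
  have [w Ww ->] := (IHk (P \o S) d).1 Dd.
  by exists (fun j => if j is j'.+1 then w j' else w0) => [[|j]|//];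
    [|exact: Ww|rewrite big_ord_recl].
rewrite big_ord_recl; exists (P 0%N *m w 0%N); first by exists (w 0%N); [exact: Ww|].
exists (\sum_(i < k) P i.+1 *m w i.+1) => //.
by apply/(IHk (P \o S)); exists (w \o S) => // j jk; exact: Ww.
Qed.

Section BackwardSets.
Context {R : realType} {n : nat}.
Variables (sA : set 'M[R]_n) (W X : set 'cV[R]_n).
Local Notation B := (backward_set sA W).
Local Notation Y := (Yset sA W X).

Lemma backward_setP (S : set 'cV[R]_n) x :
  B S x <-> succ_set sA W x `<=` S.
Proof.
split=> [BSx _ [A sAA [w Ww <-]]|sxS A sAA _ [w Ww <-]].
  by apply: (BSx A sAA); exists w.
by apply: sxS; exists A => //; exists w.
Qed.

Lemma backward_set_mono : {homo B : S T / S `<=` T}.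
Proof.
by move=> S T ST x /backward_setP sxS; apply/backward_setP; exact: subset_trans ST.
Qed.

(** The vector in the conclusion is the state at time [k] of the trajectory
that starts at [x] under the matrices [A] and the disturbances [w]. *)
Lemma YsetP k x : Y k x <->
  forall (A : nat -> 'M[R]_n) (w : nat -> 'cV[R]_n),
    (forall j, (j < k)%N -> sA (A j)) -> (forall j, (j < k)%N -> W (w j)) ->
    X (transition A k 0 *m x + \sum_(i < k) transition A k i.+1 *m w i).
Proof.
have E (A : nat -> 'M[R]_n) : transition A 0 0 = 1%:M.
  by rewrite /transition big_nil.
case: k => [|k].
  split=> [Xx A w _ _|/(_ (fun=> 0) (fun=> 0))].
    by rewrite big_ord0 addr0 E mul1mx.
  by rewrite big_ord0 addr0 E mul1mx; apply.
split=> [Yx A w sAA Ww|Yx Psi [A sAA PsiE] _ [d Dd <-]].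
  apply: (Yx (fun i => transition A k.+1 i)); first by exists A.
  eexists; last by [].
  by apply/(mem_sum_images _ _ (fun i => transition A k.+1 i.+1)); exists w.
have [w Ww ->] : exists2 w : nat -> 'cV[R]_n, forall j, (j < k.+1)%N -> W (w j) &
    d = \sum_(i < k.+1) transition A k.+1 i.+1 *m w i.
  apply/(mem_sum_images _ _ (fun i => transition A k.+1 i.+1)).
  by under eq_bigr => i _ do rewrite -[X in transition _ _ X](lift0 i) -PsiE.
by rewrite PsiE; exact: Yx.
Qed.

(** A trajectory of length [k + 1] from [x] is a first step to
[A 0 *m x + w 0], followed by a trajectory of length [k] driven by the shifted
sequences. *)
Lemma Yset_backward k : Y k.+1 = B (Y k).
Proof.
have first_step (A : nat -> 'M[R]_n) (w : nat -> 'cV[R]_n) x :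
    transition A k.+1 0 *m x +
      \sum_(i < k.+1) transition A k.+1 i.+1 *m w i =
    transition (A \o S) k 0 *m (A 0%N *m x + w 0%N) +
      \sum_(i < k) transition (A \o S) k i.+1 *m (w \o S) i.
  rewrite big_ord_recl transition_first transition_shift mulmxDr mulmxA addrA.
  by congr (_ + _); apply: eq_bigr => i _; rewrite transition_shift.
apply/seteqP; split=> x.
  move=> /YsetP Yx; apply/backward_setP => _ [A0 sA0 [w0 Ww0 <-]].
  apply/YsetP => A w sAA Ww.
  pose cons_seq T (u0 : T) u j := if j is j'.+1 then u j' else u0.
  have := Yx (cons_seq _ A0 A) (cons_seq _ w0 w).
  by rewrite first_step; apply=> -[|j] //; [exact: sAA|exact: Ww].
move=> /backward_setP BYx; apply/YsetP => A w sAA Ww; rewrite first_step.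
have /YsetP : Y k (A 0%N *m x + w 0%N).
  by apply: BYx; exists (A 0%N); [exact: sAA|exists (w 0%N); [exact: Ww|]].
by apply=> j jk; [exact: sAA|exact: Ww].
Qed.

Lemma backward_bigcap_Yset k :
  B (\bigcap_(j in `I_k) Y j) = \bigcap_(j in `I_k) Y j.+1.
Proof.
apply/seteqP; split=> x.
  move=> /backward_setP sx j jk; rewrite Yset_backward.
  by apply/backward_setP => y /sx; exact.
move=> Yx; apply/backward_setP => y xy j jk.
by have := Yx j jk; rewrite Yset_backward => /backward_setP; exact.
Qed.

Lemma bigcap_Yset_recr k :
  \bigcap_(j in `I_k.+1) Y j = \bigcap_(j in `I_k) Y j `&` Y k.
Proof. by rewrite IIS bigcap_setU bigcap_set1. Qed.

Lemma bigcap_Yset_recl k :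
  \bigcap_(j in `I_k.+1) Y j = B (\bigcap_(j in `I_k) Y j) `&` X.
Proof.
rewrite backward_bigcap_Yset; apply/seteqP; split=> x.
  by move=> Yx; split=> [j jk|]; [exact: Yx|exact: (Yx 0%N)].
by move=> [Yx Xx] [|j] //; exact: Yx.
Qed.

(** The factor [B _] carries the constraints at the times [1, ..., k + 1], the
other one those at the times [0, ..., k]; they overlap, and only time [0] is
missing from the former. *)
Lemma bigcap_Yset_backward k : \bigcap_(j in `I_k.+2) Y j =
  B (\bigcap_(j in `I_k.+1) Y j) `&` \bigcap_(j in `I_k.+1) Y j.
Proof.
apply/seteqP; split=> x.
  move=> Yx; split; last by move=> j jk; apply: Yx; exact: leqW.
  by move: Yx; rewrite bigcap_Yset_recl => -[].
by move=> [BYx Yx]; rewrite bigcap_Yset_recl; split=> //; exact: (Yx 0%N).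
Qed.

Section Recursion.
Variable r : recursion.
Local Notation Xs := (Xset sA W X r).

(** All recursions generate the same sequence: the standard one adds the
constraint at time [0] to those at times [1, ..., k + 1], the incremental one
adds the constraint at time [k + 1] to those at times [0, ..., k], and the
self-restricted one joins the two overlapping families. *)
Lemma Xset_bigcap k : Xs k = \bigcap_(j in `I_k.+1) Y j.
Proof.
elim: k => [|k IHk] /=; first by rewrite IIS II0 set0U bigcap_set1.
case: r IHk => ->.
- by rewrite -bigcap_Yset_recl.
- by rewrite -bigcap_Yset_backward.
- by rewrite -bigcap_Yset_recr.
Qed.

Lemma Xset_recr k : Xs k.+1 = Xs k `&` Y k.+1.
Proof. by rewrite !Xset_bigcap bigcap_Yset_recr. Qed.

Lemma Xset_backward k : Xs k.+1 = Xs k `&` B (Xs k).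
Proof. by rewrite !Xset_bigcap bigcap_Yset_backward setIC. Qed.

Lemma Xset_sub_constraint k : Xs k `<=` X.
Proof. by rewrite Xset_bigcap => x /(_ 0%N); exact. Qed.

Lemma Xset_stopping k :
  (Xs k `<=` Xbar sA W X r k.+1 <-> Xs k `<=` Xs k.+1) /\
  (Xs k `<=` Y k.+1 <-> Xs k `<=` Xs k.+1).
Proof.
split; [rewrite Xset_backward|rewrite Xset_recr].
  by rewrite subsetI; split=> [XB|[]//]; split.
by rewrite subsetI; split=> [XY|[]//]; split.
Qed.

(** The constraint [S `<=` X] has to be asked separately, since [B] only looks
at successors. *)
Lemma rpiE (S : set 'cV[R]_n) : rpi sA W X S <-> S `<=` B S /\ S `<=` X.
Proof.
split=> [rS|[SB SX] x Sx].
  by split=> x /rS [sx Xx]; [exact/backward_setP|].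
by split; [exact/backward_setP/SB|exact: SX].
Qed.

Lemma rpi_sub_Xset (S : set 'cV[R]_n) k : rpi sA W X S -> S `<=` Xs k.
Proof.
move=> /rpiE[SB SX]; rewrite Xset_bigcap => x Sx j _.
elim: j x Sx => [|j IHj]; first exact: SX.
by rewrite Yset_backward; apply: subset_trans SB _; exact: backward_set_mono.
Qed.

(** Here [Xs k `<=` B (Xs k)] makes [Xs k] invariant, so that
[Xs k `<=` M `<=` Xinf `<=` Xs k]. *)
Lemma max_rpi_Xset M k : max_rpi sA W X M ->
  Xs k `<=` Xs k.+1 ->
  [/\ M = Xinf sA W X r, Xinf sA W X r = Xs k & Xs k = Xs k.+1].
Proof.
move=> [rM maxM] stop.
have XM : Xs k `<=` M.
  apply/maxM/rpiE; split; last exact: Xset_sub_constraint.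
  exact: (Xset_stopping k).1.2.
have MXinf : M `<=` Xinf sA W X r.
  by move=> x Mx j _; exact: rpi_sub_Xset Mx.
have XinfX : Xinf sA W X r `<=` Xs k by move=> x; exact.
split; apply/seteqP; split=> //.
- exact: subset_trans XM.
- exact: subset_trans MXinf.
- by rewrite Xset_recr => x [].
Qed.

End Recursion.
End BackwardSets.

Theorem theorem3 (R : realType) (n : nat) (sA : set 'M[R]_n)
    (W X : set 'cV[R]_n) (sA0 : sA !=set0) (W0 : W !=set0)
    (r : recursion) (M : set 'cV[R]_n) (maxM : max_rpi sA W X M) :
  [<-> finitely_determined sA W X r M;
       exists k, Xset sA W X r k `<=` Xset sA W X r k.+1;
       exists k, Xset sA W X r k `<=` Xbar sA W X r k.+1;
       exists k, Xset sA W X r k `<=` Yset sA W X k.+1]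
  /\
  (forall k,
     [\/ Xset sA W X r k `<=` Xset sA W X r k.+1,
         Xset sA W X r k `<=` Xbar sA W X r k.+1 |
         Xset sA W X r k `<=` Yset sA W X k.+1] ->
     [/\ M = Xinf sA W X r,
         Xinf sA W X r = Xset sA W X r k &
         Xset sA W X r k = Xset sA W X r k.+1]).
Proof.
have stop k :
    [\/ Xset sA W X r k `<=` Xset sA W X r k.+1,
        Xset sA W X r k `<=` Xbar sA W X r k.+1 |
        Xset sA W X r k `<=` Yset sA W X k.+1] ->
    Xset sA W X r k `<=` Xset sA W X r k.+1.
  have [bar_stop Y_stop] := Xset_stopping sA W X r k.
  by case=> // [/bar_stop.1|/Y_stop.1].
split; last by move=> k /stop; exact: max_rpi_Xset.
tfae.
- by move=> [k MX]; exists k; rewrite -MX; apply: rpi_sub_Xset; case: maxM.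
- by move=> [k Xk]; exists k; exact: (Xset_stopping _ _ _ _ _).1.2.
- move=> [k Xk]; exists k; apply: (Xset_stopping _ _ _ _ _).2.2.
  by apply: stop; exact: Or32.
- move=> [k Xk]; exists k.
  have Xkk : Xset sA W X r k `<=` Xset sA W X r k.+1 by apply: stop; exact: Or33.
  by have [-> ->] := max_rpi_Xset maxM Xkk.
Qed.
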